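(* Let $f_{rho}(n)$ denote the maximum size of a point set $P\subseteq [1,n]\times[1,n]$ that does not contain the vertex set of a rhombus. Then $$f_{rho}(n)=\Omega\left(\frac{n^{4/3}}{(\log n)^{1/3}}\right),$$ that is, there exists a constant $c>0$ such that $f_{rho}(n)\ge c\,n^{4/3}(\log n)^{-1/3}$ for all sufficiently large integers $n$.
   Context: Here $[1,n]=\{1,2,\dots,n\}$ is an integer interval, so $[1,n]\times[1,n]$ is the $n\times n$ integer grid in the Euclidean plane. A rhombus is a non-degenerate quadrilateral (four distinct vertices, not collinear) with all four sides of equal length; squares are rhombuses. Rhombuses may be in any position (not necessarily axis-parallel). *)

(* Defs.v *)
From HB Require Import structures.
From mathcomp Require Import all_boot all_order all_algebra.
From mathcomp Require Import all_classical all_reals all_analysis.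

Set Implicit Arguments.
Unset Strict Implicit.
Unset Printing Implicit Defensive.

Import Order.TTheory GRing.Theory Num.Theory.

Local Open Scope ring_scope.

Section Rhombus.
Variable R : realType.

Definition edist (p q : R * R) : R :=
  Num.sqrt ((p.1 - q.1) ^+ 2 + (p.2 - q.2) ^+ 2).

Definition collinear (s : seq (R * R)) : Prop :=
  exists a b c : R, (a, b) <> (0, 0) /\
    (forall p, p \in s -> a * p.1 + b * p.2 = c).

(* The vertices are listed in cyclic order. *)
Definition rhombus (A B C D : R * R) : Prop :=
  [/\ uniq [:: A; B; C; D],
      ~ collinear [:: A; B; C; D],
      edist A B = edist B C,
      edist B C = edist C D &
      edist C D = edist D A].

(* 'I_n starts at 0: the pair (i, j) stands for the grid point (i + 1, j + 1)
   of [1, n] x [1, n]. *)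
Definition grid_point (n : nat) (p : 'I_n * 'I_n) : R * R :=
  ((p.1 : nat).+1%:R, (p.2 : nat).+1%:R).

Definition rhombus_free (n : nat) (P : {set 'I_n * 'I_n}) : Prop :=
  ~ exists A B C D : 'I_n * 'I_n,
      [/\ A \in P, B \in P, C \in P & D \in P] /\
      rhombus (grid_point A) (grid_point B) (grid_point C) (grid_point D).

Definition f_rho (n : nat) : nat :=
  \max_(P : {set 'I_n * 'I_n} | `[< rhombus_free P >]) #|P|.

End Rhombus.

(* Main.v *)
Require Import Defs.
From mathcomp Require Import all_boot all_order all_algebra.
From mathcomp Require Import all_classical all_reals all_analysis.
From mathcomp Require Import zify ring lra.

(* The diagonals of a rhombus bisect each other and are orthogonal, so a rhombus
   is determined by one vertex and by its diagonal vectors, which have the form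
   g (a, b) and h (- b, a).  With m := max(|a|, |b|) there are O(m) choices for
   (a, b) and O(n / m) for each of g and h; summing over m, the grid contains
   O(n^4 log n) rhombuses.  A random set of density 1 / k, from which one vertex
   of each rhombus is deleted, has on average n^2 / k - O(n^4 log n / k^4) points;
   the choice k ~ (n^2 log n)^(1/3) gives the bound. *)

Set Implicit Arguments.
Unset Strict Implicit.
Unset Printing Implicit Defensive.

Import Order.TTheory GRing.Theory Num.Theory.

(** * Independent sets in hypergraphs, by averaging *)

Section Hypergraph.
Variable V : finType.

Definition independent (E : {set {set V}}) (S : {set V}) :=
  [forall e in E, ~~ (e \subset S)].

(** Remove from [U] one chosen vertex of each edge inside [U]: an edge that survived would still
    contain its own chosen vertex. *)
Lemma delete_edges (E : {set {set V}}) (U : {set V}) :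
  finset.set0 \notin E ->
  exists2 S, independent E S & #|U| <= #|S| + #|[set e in E | e \subset U]|.
Proof.
(* The choice function [r] needs a default vertex, so an empty [V] is treated apart. *)
move=> E0; have [x0 _|V0] := pickP V; last first.
  exists finset.set0; last by rewrite (eq_card0 (fun x => _ : (x \in U) = false)) // => x; have := V0 x.
  apply/forall_inP => e eE; apply: contra E0; rewrite finset.subset0 => /eqP <-; exact: eE.
pose r (e : {set V}) := odflt x0 [pick x in e].
exists (U :\: r @: [set e in E | e \subset U]).
  apply/forall_inP => e eE; apply/negP => eS.
  have eU : e \subset U by apply: fintype.subset_trans eS (finset.subsetDl _ _).
  have re : r e \in e.
    rewrite /r; case: pickP => //= e0; case/negP: E0.
    by have -> : finset.set0 = e by apply/finset.setP=> x; rewrite e0 inE.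
  have := fintype.subsetP eS _ re; rewrite !inE => /andP[/imsetP[]].
  by exists e => //; rewrite inE eE.
rewrite -(cardsID (r @: [set e in E | e \subset U]) U) addnC leq_add2l.
exact: leq_trans (subset_leq_card (finset.subsetIr _ _)) (leq_imset_card _ _).
Qed.

(** Colours are forced on [e] and free elsewhere, so these colourings form a product family. *)
Lemma card_ffun_eq0_on k (e : {set V}) :
  #|[set f : {ffun V -> 'I_k.+1} | e \subset [set x | f x == ord0]]|
    = k.+1 ^ (#|V| - #|e|).
Proof.
pose F x := if x \in e then pred1 (ord0 : 'I_k.+1) else predT.
rewrite -(@eq_card _ (mem (family F))); last first.
  move=> f; rewrite inE; apply/familyP/fintype.subsetP => fF x.
    by move=> xe; have := fF x; rewrite /F xe !inE.
  by rewrite /F; case: ifP => // xe; have := fF x xe; rewrite !inE.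
rewrite card_family foldrE big_map big_enum /=.
rewrite (bigID (mem e)) /= big1 ?mul1n; last first.
  by move=> x xe; rewrite /F xe card1.
rewrite (eq_bigr (fun=> k.+1)); last first.
  by move=> x /negbTE xe; rewrite /F xe eq_cardT // size_enum_ord.
rewrite prod_nat_const; congr (_ ^ _).
by rewrite -(cardC (mem e)) addnC addnK.
Qed.

(* Averaging over all colourings with k.+1 colours: delete one vertex from each edge
   inside the class of colour 0. *)
Lemma independent_set_bound (E : {set {set V}}) k :
  (forall e, e \in E -> #|e| = 4) ->
  exists2 S, independent E S & #|V| * k.+1 ^ 3 <= k.+1 ^ 4 * #|S| + #|E|.
Proof.
move=> E4.
have E0 : finset.set0 \notin E by apply/negP => /E4; rewrite cards0.
(* An edge guarantees at least 4 vertices, so that the exponent [#|V| - 4] below is not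
   truncated. *)
have [-> |[e eE]] := set_0Vmem E.
  exists [set: V]; first by apply/forall_inP => e; rewrite inE.
  by rewrite cardsT; nia.
have V4 : 4 <= #|V| by rewrite -(E4 e eE) max_card.
have ind0 : independent E finset.set0.
  by apply/forall_inP => e' e'E; rewrite finset.subset0; apply: contraNneq E0 => <-.
(* A largest independent set bounds the outcome of the deletion for all colourings at once. *)
case: (arg_maxnP (fun S : {set V} => #|S|) ind0) => S indS Smax.
exists S => //.
pose U (f : {ffun V -> 'I_k.+1}) := [set x | f x == ord0].
have le_f f : #|U f| <= #|S| + #|[set e in E | e \subset U f]|.
  have [S' indS' /leq_trans->//] := delete_edges (U f) E0.
  by rewrite leq_add2r; apply: Smax.
have sumU : \sum_f #|U f| = #|V| * k.+1 ^ (#|V| - 1).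
  under eq_bigr do rewrite -sum1_card big_mkcond /=.
  rewrite exchange_big /= -sum_nat_const; apply: eq_bigr => x _.
  rewrite -big_mkcond sum1dep_card -(cards1 x) -card_ffun_eq0_on.
  by apply: eq_card => f; rewrite !inE finset.sub1set inE.
have sumE : \sum_f #|[set e in E | e \subset U f]| = #|E| * k.+1 ^ (#|V| - 4).
  under eq_bigr do rewrite -sum1_card big_mkcond /=.
  rewrite exchange_big /= -sum_nat_const [RHS]big_mkcond; apply: eq_bigr => x _.
  case: ifP => xE; last by rewrite big1 // => f _; rewrite inE xE.
  rewrite -big_mkcond sum1dep_card -(E4 x xE) -card_ffun_eq0_on.
  by apply: eq_card => f; rewrite !inE xE.
have : \sum_f #|U f| <= \sum_f (#|S| + #|[set e in E | e \subset U f]|).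
  exact: leq_sum.
rewrite sumU big_split /= sumE sum_nat_const card_ffun card_ord.
have -> : #|V| - 1 = 3 + (#|V| - 4) by lia.
have -> : k.+1 ^ #|V| = k.+1 ^ (4 + (#|V| - 4)) by congr (_ ^ _); lia.
rewrite !expnD => le_sum; rewrite -(@leq_pmul2r (k.+1 ^ (#|V| - 4))) ?expn_gt0 //.
by rewrite mulnDl -mulnA [X in _ <= X + _]mulnAC.
Qed.

End Hypergraph.

(** * Pairs of orthogonal integer vectors *)

Local Open Scope ring_scope.

(** Dividing [u] by its gcd [g] leaves a primitive vector [(a, b)] with [x * a + y * b = 1]. This
    relation makes every integer vector orthogonal to [(a, b)] an integer multiple of [(- b, a)],
    with factor [x * v2 - y * v1]. *)
Lemma orthogonal_param (u1 u2 v1 v2 : int) :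
  (u1, u2) <> (0, 0) -> u1 * v1 + u2 * v2 = 0 ->
  exists a b g h : int,
    [/\ (a, b) <> (0, 0), g != 0, u1 = g * a /\ u2 = g * b
      & v1 = - h * b /\ v2 = h * a].
Proof.
move=> u0 uv; have [x [y xy]] := Bezoutz u1 u2.
have g0 : gcdz u1 u2 != 0.
  apply/eqP => /eqP; rewrite gcdz_eq0 => /andP[/eqP u10 /eqP u20].
  by apply: u0; rewrite u10 u20.
have /dvdzP[a ua] := dvdz_gcdl u1 u2; have /dvdzP[b ub] := dvdz_gcdr u1 u2.
move: g0 xy ua ub; set g := gcdz u1 u2 => g0 xy ua ub.
have ab : x * a + y * b = 1.
  by apply: (mulfI g0); rewrite mulr1 -[RHS]xy ua ub; ring.
have avb : a * v1 + b * v2 = 0.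
  by apply: (mulfI g0); rewrite mulr0 -uv ua ub; ring.
exists a, b, g, (x * v2 - y * v1); split => //.
- by move=> [a0 b0]; move: ab; rewrite a0 b0 !mulr0.
- by rewrite ua ub; split; ring.
- split.
    rewrite -[LHS]mul1r -ab.
    have -> : - (x * v2 - y * v1) * b = y * b * v1 - x * (b * v2) by ring.
    by rewrite (_ : b * v2 = - (a * v1)); [ring | rewrite -[RHS]addr0 -avb; ring].
  rewrite -[LHS]mul1r -ab.
  have -> : (x * v2 - y * v1) * a = x * a * v2 - y * (a * v1) by ring.
  by rewrite (_ : a * v1 = - (b * v2)); [ring | rewrite -[RHS]addr0 -avb; ring].
Qed.

Lemma norm_le_divn (n m : nat) (g : int) :
  (0 < m)%N -> `|g * m| <= n -> `|g| <= (n %/ m)%N.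
Proof. by move=> m0; move=> gm; rewrite -abszE lez_nat leq_divRL //; lia. Qed.

(** Here [m] is the larger of [|a|] and [|b|], [s] tells which coordinate attains it, and [j] is the
    other coordinate up to sign. A negative sign of the large coordinate is absorbed into [g] and
    [h]; [m <= n] follows from [g != 0]. *)
Lemma orthogonal_param_bounded (n : nat) (u1 u2 v1 v2 : int) :
  `|u1| <= n -> `|u2| <= n -> `|v1| <= n -> `|v2| <= n ->
  (u1, u2) <> (0, 0) -> u1 * v1 + u2 * v2 = 0 ->
  exists (m : nat) (s : bool) (j g h : int),
    [/\ (0 < m <= n)%N, `|j| <= m, `|g| <= (n %/ m)%N /\ `|h| <= (n %/ m)%N,
        (u1, u2) = if s then (g * m, g * j) else (g * j, g * m)
      & (v1, v2) = if s then (- h * j, h * m) else (- h * m, h * j)].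
Proof.
move=> u1n u2n v1n v2n u0 uv.
have [a [b [g [h [ab0 g0 [ua ub] [va vb]]]]]] := orthogonal_param u0 uv.
have main (m : nat) (j g' h' : int) (s : bool) : (0 < m)%N -> `|j| <= m ->
    `|g' * m| <= n -> `|h' * m| <= n -> g' != 0 ->
    (u1, u2) = (if s then (g' * m, g' * j) else (g' * j, g' * m)) ->
    (v1, v2) = (if s then (- h' * j, h' * m) else (- h' * m, h' * j)) ->
    exists (m : nat) (s : bool) (j g h : int),
    [/\ (0 < m <= n)%N, `|j| <= m, `|g| <= (n %/ m)%N /\ `|h| <= (n %/ m)%N,
        (u1, u2) = if s then (g * m, g * j) else (g * j, g * m)
      & (v1, v2) = if s then (- h * j, h * m) else (- h * m, h * j)].
  move=> m0 jm gm hm g'0 -> ->; exists m, s, j, g', h'; split=> //; first by nia.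
  by split; apply: norm_le_divn.
rewrite ua in u1n; rewrite ub in u2n; rewrite va mulNr normrN in v1n; rewrite vb in v2n.
have [ab|ab] := leP `|b| `|a|.
  have a0 : (0 < `|a|)%N by rewrite absz_gt0; apply/eqP => a0; apply: ab0; congr pair; lia.
  case: (ltP a 0) => sa.
    apply: (main `|a|%N (- b) (- g) (- h) true); rewrite ?oppr_eq0 //; try lia.
      by rewrite ua ub; congr pair; rewrite ?lt0_norm //; lia.
    by rewrite va vb; congr pair; rewrite ?lt0_norm //; lia.
  apply: (main `|a|%N b g h true); rewrite //; try lia.
    by rewrite ua ub; congr pair; lia.
  by rewrite va vb; congr pair; lia.
have b0 : (0 < `|b|)%N by lia.
case: (ltP b 0) => sb.
  apply: (main `|b|%N (- a) (- g) (- h) false); rewrite ?oppr_eq0 //; try lia.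
    by rewrite ua ub; congr pair; lia.
  by rewrite va vb; congr pair; lia.
apply: (main `|b|%N a g h false); rewrite //; try lia.
  by rewrite ua ub; congr pair; lia.
by rewrite va vb; congr pair; lia.
Qed.

(** * Diagonals of a rhombus *)

Lemma edist_eq (R : realType) (A B C D : R * R) : Defs.edist A B = Defs.edist C D ->
  (A.1 - B.1) ^+ 2 + (A.2 - B.2) ^+ 2 = (C.1 - D.1) ^+ 2 + (C.2 - D.2) ^+ 2.
Proof.
by move/eqP; rewrite eqr_sqrt ?addr_ge0 ?sqr_ge0 // => /eqP.
Qed.

Lemma sum_sqr_neq0 (R : realType) (A B : R * R) : A != B ->
  (A.1 - B.1) ^+ 2 + (A.2 - B.2) ^+ 2 != 0.
Proof.
case: A B => [a1 a2] [b1 b2]; apply: contraNneq => /eqP /=.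
by rewrite paddr_eq0 ?sqr_ge0 // !sqrf_eq0 !subr_eq0.
Qed.

(** Equal sides put [B] and [D] on the perpendicular bisector of [AC], and conversely. Hence
    [w = A + C - B - D] is orthogonal to both diagonals, which are nonzero and orthogonal to each
    other, so [w = 0]. *)
Lemma rhombus_diagonals (R : realType) (A B C D : R * R) : rhombus A B C D ->
  [/\ A.1 + C.1 = B.1 + D.1, A.2 + C.2 = B.2 + D.2
    & (C.1 - A.1) * (B.1 - D.1) + (C.2 - A.2) * (B.2 - D.2) = 0].
Proof.
case=> /= /and4P[]; rewrite !inE !negb_or.
move=> /and3P[_ AC _] /andP[_ BD] _ _ _ /edist_eq e1 /edist_eq e2 /edist_eq e3.
have p0 := sum_sqr_neq0 AC; have q0 := sum_sqr_neq0 BD.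
move: A B C D {AC BD} e1 e2 e3 p0 q0.
move=> [a1 a2] [b1 b2] [c1 c2] [d1 d2] /= e1 e2 e3 p0 q0.
have pq : (c1 - a1) * (b1 - d1) + (c2 - a2) * (b2 - d2) = 0 by lra.
pose w1 := a1 + c1 - (b1 + d1); pose w2 := a2 + c2 - (b2 + d2).
have wp : w1 * (a1 - c1) + w2 * (a2 - c2) = 0 by rewrite /w1 /w2; lra.
have wq : w1 * (b1 - d1) + w2 * (b2 - d2) = 0 by rewrite /w1 /w2; lra.
(* In the plane, [w] and [BD] are both orthogonal to [AC], hence parallel; the factor [p0] is the
   squared length of [AC]. *)
have cross : w1 * (b2 - d2) - w2 * (b1 - d1) = 0.
  apply: (mulfI p0); rewrite mulr0.
  have -> : ((a1 - c1) ^+ 2 + (a2 - c2) ^+ 2) * (w1 * (b2 - d2) - w2 * (b1 - d1))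
    = (w1 * (a1 - c1) + w2 * (a2 - c2)) *
      ((a1 - c1) * (b2 - d2) - (a2 - c2) * (b1 - d1))
      + ((c1 - a1) * (b1 - d1) + (c2 - a2) * (b2 - d2)) *
        (w2 * (a1 - c1) - w1 * (a2 - c2)) by ring.
  by rewrite wp pq !mul0r addr0.
split=> //; apply/eqP; rewrite -subr_eq0; apply/eqP; apply: (mulfI q0);
  rewrite mulr0 -/w1 -/w2.
  have -> : ((b1 - d1) ^+ 2 + (b2 - d2) ^+ 2) * w1
    = (b1 - d1) * (w1 * (b1 - d1) + w2 * (b2 - d2))
      + (b2 - d2) * (w1 * (b2 - d2) - w2 * (b1 - d1)) by ring.
  by rewrite wq cross !mulr0 addr0.
have -> : ((b1 - d1) ^+ 2 + (b2 - d2) ^+ 2) * w2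
  = (b2 - d2) * (w1 * (b1 - d1) + w2 * (b2 - d2))
    - (b1 - d1) * (w1 * (b2 - d2) - w2 * (b1 - d1)) by ring.
by rewrite wq cross !mulr0 subr0.
Qed.

Lemma grid_rhombus_diagonals (R : realType) n (A B C D : 'I_n * 'I_n) :
  rhombus (grid_point R A) (grid_point R B) (grid_point R C) (grid_point R D) ->
  [/\ uniq [:: A; B; C; D], (A.1 + C.1 = B.1 + D.1)%N,
      (A.2 + C.2 = B.2 + D.2)%N
    & (C.1%:Z - A.1%:Z) * (B.1%:Z - D.1%:Z)
      + (C.2%:Z - A.2%:Z) * (B.2%:Z - D.2%:Z) = 0].
Proof.
move=> rh; have [e1 e2 e3] := rhombus_diagonals rh; split.
- case: rh => un _ _ _ _; apply: (@map_uniq _ _ (@grid_point R n)); exact: un.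
- by move: e1; rewrite /= -!natrD => /eqP; rewrite eqr_nat => /eqP; lia.
- by move: e2; rewrite /= -!natrD => /eqP; rewrite eqr_nat => /eqP; lia.
apply: (@intr_inj R); rewrite rmorph0 rmorphD !rmorphM !rmorphB /=.
move: e3; rewrite /= -![_.+1%:R]natr1 -!pmulrn => e3; rewrite -[RHS]e3; ring.
Qed.

(** * Counting the rhombuses of the grid *)

Lemma absz_shift_lt (c : nat) (x : int) :
  `|x| <= c -> (`|(x + c)%R|%N < (2 * c).+1)%N.
Proof. by lia. Qed.

Lemma absz_shiftK (c : nat) (x : int) : `|x| <= c -> `|(x + c)%R|%N%:Z - c%:Z = x.
Proof. by lia. Qed.

Section Count.
Variable n : nat.
Local Notation V := ('I_n.+1 * 'I_n.+1)%type.

(* The quadruple A, B, C, D with A + C = B + D, C - A = (u1, u2) and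
   B - D = (v1, v2), when it fits in the grid (junk otherwise). *)
Definition quad_of_diagonals (A : V) (u v : int * int) : {set V} :=
  let pt (x y : int) : V := (inord `|x|%N, inord `|y|%N) in
  let half (x y : int) : V := (inord `|x|./2, inord `|y|./2) in
  [set A; half (2 * A.1%:Z + u.1 + v.1) (2 * A.2%:Z + u.2 + v.2);
          pt (A.1%:Z + u.1) (A.2%:Z + u.2);
          half (2 * A.1%:Z + u.1 - v.1) (2 * A.2%:Z + u.2 - v.2)].

(** From [A + C = B + D] one gets [2 B = 2 A + u + v] and [2 D = 2 A + u - v], so the halvings are
    exact. *)
Lemma quad_of_diagonalsE (A B C D : V) :
  (A.1 + C.1 = B.1 + D.1)%N -> (A.2 + C.2 = B.2 + D.2)%N ->
  quad_of_diagonals A (C.1%:Z - A.1%:Z, C.2%:Z - A.2%:Z)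
                      (B.1%:Z - D.1%:Z, B.2%:Z - D.2%:Z) = [set A; B; C; D].
Proof.
move=> e1 e2; rewrite /quad_of_diagonals /=.
have inordE (k : nat) (i : 'I_n.+1) : k = i -> inord k = i.
  by move=> ->; rewrite inord_val.
congr [set _; _; _; _].
- by case: B e1 e2 => [b1 b2] /= e1 e2; congr pair; apply: inordE; lia.
- by case: C e1 e2 => [c1 c2] /= e1 e2; congr pair; apply: inordE; lia.
- by case: D e1 e2 => [d1 d2] /= e1 e2; congr pair; apply: inordE; lia.
Qed.

(* Parameters of a pair of orthogonal vectors: with m := (tag p).+1, these are
   g (m, j) and h (- j, m), or the same with the coordinates m and j exchanged;
   j, g and h are shifted to become ordinals. *)
Definition orth_param := {m : 'I_n.+1 &
  (bool * 'I_(2 * m.+1).+1 * 'I_(2 * (n.+1 %/ m.+1)).+1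
   * 'I_(2 * (n.+1 %/ m.+1)).+1)%type}.

Definition orth_pair (p : orth_param) : (int * int) * (int * int) :=
  let m : int := (tag p).+1 in
  let: (s, j, g, h) := tagged p in
  let j := j%:Z - m in
  let g := g%:Z - (n.+1 %/ (tag p).+1)%N%:Z in
  let h := h%:Z - (n.+1 %/ (tag p).+1)%N%:Z in
  if s then ((g * m, g * j), (- h * j, h * m))
  else ((g * j, g * m), (- h * m, h * j)).

Lemma orth_pair_surj (u v : int * int) :
  `|u.1| <= n.+1 -> `|u.2| <= n.+1 -> `|v.1| <= n.+1 -> `|v.2| <= n.+1 ->
  u <> (0, 0) -> u.1 * v.1 + u.2 * v.2 = 0 ->
  exists p, orth_pair p = (u, v).
Proof.
case: u v => [u1 u2] [v1 v2] /= u1n u2n v1n v2n u0 uv.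
have [m [s [j [g [h [/andP[m0 mn] jm [gm hm] uE vE]]]]]] :=
  orthogonal_param_bounded u1n u2n v1n v2n u0 uv.
(* The tag stores [m - 1], since [m] runs from 1 to [n.+1]. *)
have mn' : (m.-1 < n.+1)%N by lia.
have mS : m.-1.+1 = m by lia.
have jP : (`|(j + m.-1.+1)%R|%N < (2 * m.-1.+1).+1)%N by apply: absz_shift_lt; rewrite mS.
have gP : (`|(g + (n.+1 %/ m.-1.+1)%N)%R|%N < (2 * (n.+1 %/ m.-1.+1)).+1)%N.
  by apply: absz_shift_lt; rewrite mS.
have hP : (`|(h + (n.+1 %/ m.-1.+1)%N)%R|%N < (2 * (n.+1 %/ m.-1.+1)).+1)%N.
  by apply: absz_shift_lt; rewrite mS.
exists (Tagged (fun m : 'I_n.+1 => (bool * 'I_(2 * m.+1).+1 *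
  'I_(2 * (n.+1 %/ m.+1)).+1 * 'I_(2 * (n.+1 %/ m.+1)).+1)%type)
  ((s, Ordinal jP, Ordinal gP, Ordinal hP) : (bool * 'I_(2 * (Ordinal mn').+1).+1 *
  'I_(2 * (n.+1 %/ (Ordinal mn').+1)).+1 * 'I_(2 * (n.+1 %/ (Ordinal mn').+1)).+1)%type)).
rewrite /orth_pair /= !mS !absz_shiftK //.
by rewrite uE vE; case: (s).
Qed.

Lemma card_orth_param : #|{: orth_param}| =
  (\sum_(m < n.+1) 2 * (2 * m.+1).+1 * (2 * (n.+1 %/ m.+1)).+1 ^ 2)%N.
Proof.
rewrite card_tagged sumnE big_map big_enum /=; apply: eq_bigr => m _.
by rewrite !card_prod card_bool !card_ord; lia.
Qed.

(** The image covers the vertex sets of all rhombuses; repetitions and junk values are harmless for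
    an upper bound on their number. *)
Definition quad (p : V * orth_param) : {set V} :=
  let: (u, v) := orth_pair p.2 in quad_of_diagonals p.1 u v.

Lemma grid_rhombus_quad (R : realType) (A B C D : V) :
  rhombus (grid_point R A) (grid_point R B) (grid_point R C) (grid_point R D) ->
  [set A; B; C; D] \in quad @: predT /\ #|[set A; B; C; D]| = 4%N.
Proof.
move=> /grid_rhombus_diagonals[un e1 e2 e3]; split.
  have [|||||p pE] := @orth_pair_surj (C.1%:Z - A.1%:Z, C.2%:Z - A.2%:Z)
    (B.1%:Z - D.1%:Z, B.2%:Z - D.2%:Z) _ _ _ _ _ e3 => /=.
  - by have := ltn_ord A.1; have := ltn_ord C.1; lia.
  - by have := ltn_ord A.2; have := ltn_ord C.2; lia.
  - by have := ltn_ord B.1; have := ltn_ord D.1; lia.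
  - by have := ltn_ord B.2; have := ltn_ord D.2; lia.
  - move: un => /= /and4P[]; rewrite !inE !negb_or => /and3P[_ /eqP AC _] _ _ _.
    move=> [c1 c2]; apply: AC; case: A C {e1 e2 e3} c1 c2 => [a1 a2] [c1 c2] /= h1 h2.
    by congr pair; apply: val_inj => /=; lia.
  apply/imsetP; exists (A, p) => //.
  by rewrite /quad /= pE quad_of_diagonalsE.
have -> : [set A; B; C; D] = [set x in [:: A; B; C; D]].
  by apply/setP => x; rewrite !inE -!orbA.
by rewrite cardsE (card_uniqP un).
Qed.

(** The edges are the four-element values of [quad]. Every rhombus is among them, so an independent
    set is rhombus-free. *)
Lemma rhombus_free_set_bound (R : realType) (k : nat) :
  (n.+1 ^ 2 * k.+1 ^ 3 <=
   k.+1 ^ 4 * f_rho R n.+1 + n.+1 ^ 2 * #|{: orth_param}|)%N.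
Proof.
pose E := [set e in quad @: predT | #|e| == 4%N].
have [|S indS] := @independent_set_bound _ E k.
  by move=> e; rewrite inE => /andP[_ /eqP].
rewrite card_prod card_ord => leS; apply: leq_trans leS _; apply: leq_add.
  rewrite leq_mul2l; apply/orP; right.
  apply: (@leq_bigmax_cond _ _ (fun P : {set V} => #|P|) S).
  apply/asboolP => -[A [B [C [D [[AS BS CS DS] rh]]]]].
  have [qE q4] := grid_rhombus_quad rh.
  have /forall_inP/(_ [set A; B; C; D]) := indS.
  rewrite inE qE q4 eqxx => /(_ isT)/negP; apply.
  by apply/fintype.subsetP => x; rewrite !inE -!orbA => /or4P[] /eqP ->.
apply: (@leq_trans #|quad @: predT|).
  by apply: subset_leq_card; apply/fintype.subsetP => e; rewrite inE => /andP[].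
apply: leq_trans (leq_imset_card _ _) _.
by rewrite !card_prod !card_ord.
Qed.
End Count.

(** * Estimates and choice of the density *)

Lemma harmonic_sum_le_ln (R : realType) (n : nat) :
  \sum_(m < n.+1) m.+1%:R^-1 <= 1 + ln n.+1%:R :> R.
Proof.
elim: n => [|n IH]; first by rewrite big_ord1 ln1 invr1 addr0.
rewrite big_ord_recr /=.
have n1 : 0 < n.+1%:R :> R by rewrite ltr0n.
have n2 : 0 < n.+2%:R :> R by rewrite ltr0n.
have i0 : 0 < n.+2%:R^-1 :> R by rewrite invr_gt0.
have i1 : n.+2%:R^-1 < 1 :> R by rewrite invf_lt1 // ltr1n.
(* This says that the new term is at most [ln (n + 2) - ln (n + 1)]. *)
have : ln (1 + - n.+2%:R^-1) <= - n.+2%:R^-1 :> R by apply: le_ln1Dx; rewrite ltrN2.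
have -> : 1 + - n.+2%:R^-1 = n.+1%:R / n.+2%:R :> R.
  have -> : n.+1%:R = n.+2%:R - 1 :> R by rewrite -[n.+2%:R]natr1 addrK.
  by rewrite mulrBl mul1r divff // gt_eqF.
rewrite ln_div ?posrE //; move: (n.+2%:R^-1) => i ? ; lra.
Qed.

(** Let [M = m + 1] and let [q >= 1] be the quotient. Then [2 M + 1 <= 3 M], [2 q + 1 <= 3 q] and
    [q M <= n + 1], so each term is at most [54 (n + 1)^2 / M], where [54 = 2 * 3 * 9]. *)
Lemma sum_orth_param_le (R : realType) (n : nat) :
  (\sum_(m < n.+1) 2 * (2 * m.+1).+1 * (2 * (n.+1 %/ m.+1)).+1 ^ 2)%N%:R
    <= 54 * n.+1%:R ^+ 2 * (1 + ln n.+1%:R) :> R.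
Proof.
apply: le_trans (_ : _ <= 54 * n.+1%:R ^+ 2 * \sum_(m < n.+1) m.+1%:R^-1) _;
  last by rewrite ler_wpM2l ?harmonic_sum_le_ln // mulr_ge0 ?sqr_ge0.
rewrite natr_sum mulr_sumr; apply: ler_sum => m _.
have m0 : 0 < m.+1%:R :> R by rewrite ltr0n.
rewrite ler_pdivlMr // -[_ ^+ 2]natrX -!natrM ler_nat.
have mn : (m.+1 <= n.+1)%N := ltn_ord m.
have q0 : (0 < n.+1 %/ m.+1)%N by rewrite divn_gt0.
have qn := leq_trunc_div n.+1 m.+1.
apply: (@leq_trans (54 * ((n.+1 %/ m.+1) * m.+1) ^ 2)); last first.
  by rewrite leq_mul2l /= leq_exp2r.
move: (n.+1 %/ m.+1)%N q0 => q q0.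
apply: (@leq_trans (2 * (3 * m.+1) * (3 * q) ^ 2 * m.+1)); last by rewrite !expnMn; lia.
rewrite leq_mul2r /=; apply: leq_mul; first by lia.
by rewrite leq_exp2r //; lia.
Qed.

Lemma asymptotic_bound (R : realType) (n f T : nat) : (4 <= n)%N ->
  (forall k, n ^ 2 * k.+1 ^ 3 <= k.+1 ^ 4 * f + n ^ 2 * T)%N ->
  T%:R <= 54 * n%:R ^+ 2 * (1 + ln n%:R) :> R ->
  24^-1 * n%:R `^ (4 / 3) * (ln n%:R) `^ (- (1 / 3)) <= f%:R :> R.
Proof.
move=> n3 bound Tle.
have n0 : 0 < n%:R :> R by rewrite ltr0n; lia.
(* [ln (1 - 1/2) <= - 1/2] gives [ln 2 >= 1/2], hence [ln 4 >= 1]. *)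
have ln1 : 1 <= ln n%:R :> R.
  have half : ln (1 + - 2^-1) <= - 2^-1 :> R by apply: le_ln1Dx; lra.
  have le2 : ln 2 <= ln n%:R / 2 :> R.
    suff : ln (2 * 2) <= ln n%:R :> R by rewrite lnM ?posrE //; lra.
    by rewrite ler_ln ?posrE // -natrM ler_nat.
  move: half; rewrite (_ : 1 + - 2^-1 = 2^-1); last by lra.
  rewrite lnV ?posrE //; lra.
pose a : R := n%:R `^ (1 / 3); pose b : R := (ln n%:R) `^ (1 / 3).
have a0 : 0 < a by rewrite powR_gt0.
have b0 : 0 < b by rewrite powR_gt0 //; lra.
have a3 : a ^+ 3 = n%:R.
  rewrite -powR_mulrn ?ltW // -powRrM (_ : 1 / 3 * 3 = 1); last by field.
  by rewrite powRr1 ?ltW.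
have b3 : b ^+ 3 = ln n%:R.
  rewrite -powR_mulrn ?ltW // -powRrM (_ : 1 / 3 * 3 = 1); last by field.
  by rewrite powRr1; lra.
have -> : n%:R `^ (4 / 3) = a ^+ 4.
  by rewrite -powR_mulrn ?ltW // -powRrM; congr (_ `^ _); field.
rewrite powRN -/b.
have one : 1 `^ (1 / 3) = 1 :> R by rewrite powR1.
have a1 : 1 <= a.
  by rewrite -one ge0_ler_powR ?nnegrE //; try lra; rewrite ler1n; lia.
have b1 : 1 <= b.
  by rewrite -one ge0_ler_powR ?nnegrE //; lra.
(* The factor 6 makes [x ^+ 3 = 216 n^2 ln n], which is at least [2 T] because
   [1 + ln n <= 2 ln n]. *)
pose x := 6 * a ^+ 2 * b.
have a21 : 1 <= a ^+ 2 by rewrite expr_ge1 // ltW.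
have x1 : 1 <= x by rewrite /x; nra.
have x0 : 0 <= x by lra.
have /andP[kx xk] := truncn_itv x0.
move: (Num.truncn x) kx xk => k kx xk.
have K2 : k.+1%:R <= 2 * x by rewrite -natr1; lra.
have K0 : 0 < k.+1%:R :> R by rewrite ltr0n.
have K3 : 2 * T%:R <= k.+1%:R ^+ 3 :> R.
  apply: (@le_trans _ _ (x ^+ 3)); last by rewrite lerXn2r ?nnegrE // ltW.
  have -> : x ^+ 3 = 216 * n%:R ^+ 2 * ln n%:R.
    by rewrite /x -b3 -a3; ring.
  have : 0 < n%:R ^+ 2 :> R by rewrite exprn_gt0.
  nra.
have bk : n%:R ^+ 2 * k.+1%:R ^+ 3 <= k.+1%:R ^+ 4 * f%:R + n%:R ^+ 2 * T%:R :> R.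
  by rewrite -!natrX -!natrM -natrD ler_nat.
have n20 : 0 < n%:R ^+ 2 :> R by rewrite exprn_gt0.
(* By [K3] the edge term takes at most half of the left side of [bk]. With [k + 1 <= 2 x] this
   yields the constant [24 = 2 * 2 * 6]. *)
have main : n%:R ^+ 2 <= 2 * k.+1%:R * f%:R :> R.
  rewrite -(@ler_pM2r _ (k.+1%:R ^+ 3)) ?exprn_gt0 //.
  have : n%:R ^+ 2 * (2 * T%:R) <= n%:R ^+ 2 * k.+1%:R ^+ 3 :> R.
    by rewrite ler_pM2l.
  have -> : 2 * k.+1%:R * f%:R * k.+1%:R ^+ 3 = 2 * (k.+1%:R ^+ 4 * f%:R) :> R by ring.
  by lra.
have f0 : 0 <= f%:R :> R by rewrite ler0n.
have main2 : n%:R ^+ 2 <= 24 * a ^+ 2 * b * f%:R.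
  apply: (le_trans main); rewrite /x in K2.
  have -> : 24 * a ^+ 2 * b * f%:R = 2 * (2 * (6 * a ^+ 2 * b)) * f%:R by ring.
  by rewrite ler_wpM2r // ler_wpM2l.
rewrite ler_pdivrMr // -(@ler_pM2l _ (24 * a ^+ 2)); last by nra.
have -> : 24 * a ^+ 2 * (24^-1 * a ^+ 4) = n%:R ^+ 2 by rewrite -a3; field.
by apply: (le_trans main2); rewrite le_eqVlt; apply/orP; left; apply/eqP; ring.
Qed.

Theorem theorem3p7 (R : realType) :
  exists c : R, 0 < c /\
    exists N : nat, forall n : nat, (N <= n)%N ->
      c * n%:R `^ (4 / 3) * (ln n%:R) `^ (- (1 / 3)) <= (f_rho R n)%:R.
Proof.
exists 24^-1; split; first by rewrite invr_gt0.
exists 4%N => -[//|n] n4.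
apply: (asymptotic_bound n4 (rhombus_free_set_bound n R)).
by rewrite card_orth_param; apply: sum_orth_param_le.
Qed.
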